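(* For every $n\ge 1$, the map $\gamma:\mathcal{M}_n\to\mathcal{Y}_n$, from the lattice $\mathcal{M}_n$ of painted trees with $n$ leaves to the Tamari lattice $\mathcal{Y}_n$ of binary trees with $n$ internal nodes, which replaces the painted portion of a painted tree by a corolla, is an interval retract.
   Context: Binary trees. A planar rooted binary tree (binary tree) with $m$ internal nodes has $m+1$ leaves; $\mathcal{Y}_m$ denotes the set of these. Internal nodes are numbered $1,\dots,m$ from left to right (in-order: node $i$ separates the $i$-th leaf from the $(i+1)$-st leaf), and are also partially ordered by proximity to the root, the root being maximal (the node poset). An upper order ideal of the node poset is a subset containing, with any node, all nodes on the path from it to the root. $\mathcal{Y}_m$ carries the Tamari order: the partial order generated by replacing a subtree $((a\,b)\,c)$ by $(a\,(b\,c))$, the latter being larger; left combs are minimal and right combs maximal. Painted trees. A painted tree $p=(t;P)$ is a binary tree $t$ with a (possibly empty) upper order ideal $P$ of its node poset, the painted nodes. Its painted portion is the binary tree formed by the painted nodes, with $k=|P|+1$ leaves (a single edge if $P=\emptyset$); the parts of $t$ above these $k$ leaves form the ordered unpainted forest $(f_1,\dots,f_k)$ of binary trees (some possibly a single leaf with no nodes), listed left to right. $\mathcal{M}_n$ denotes the set of painted trees with $n$ leaves (i.e. $n-1$ internal nodes), with order $(s;S)\le(t;T)$ if $s\le t$ in the Tamari order on $\mathcal{Y}_{n-1}$ and $T\subseteq S$ as subsets of $\{1,\dots,n-1\}$. It is a finite lattice. (Under the bijection from bi-leveled trees with $n$ nodes to painted trees with $n-1$ nodes which removes the leftmost branch and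 node, this is the order on bi-leveled trees.) The map. Replacing the painted portion of $p$ by a corolla (one node with $k$ leaves) amounts to retaining only the ordered unpainted forest $(f_1,\dots,f_k)$, which has $n$ leaves in total. Ordered forests of binary trees with $n$ leaves in total are identified with $\mathcal{Y}_n$ by attaching the trees in left-to-right order to a single new limb which becomes the left limb: $(f_1,\dots,f_k)\mapsto(\cdots((\,|\,f_1)f_2)\cdots f_k)$, where $|$ is a new leftmost leaf. So $\gamma(p)=(\cdots((\,|\,f_1)f_2)\cdots f_k)\in\mathcal{Y}_n$. Interval retract. An interval of a poset is a sub-poset $[a,b]=\{x\mid a\le x\le b\}$. A surjective poset map (order-preserving map) $f:P\to Q$ from a finite lattice $P$ is an interval retract if the fibers of $f$ are intervals and $f$ admits an order-preserving section $g:Q\to P$ with $f\circ g=\mathrm{id}$. *)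

(* Defs.v *)
From HB Require Import structures.
From mathcomp Require Import all_boot all_order.

Set Implicit Arguments.
Unset Strict Implicit.
Unset Printing Implicit Defensive.

Import Order.TTheory.
Local Open Scope order_scope.

Inductive tree := Leaf | Node of tree & tree.

Fixpoint tree_encode (t : tree) : GenTree.tree void :=
  if t is Node l r then GenTree.Node 1 [:: tree_encode l; tree_encode r]
  else GenTree.Node 0 [::].

Fixpoint tree_decode (u : GenTree.tree void) : option tree :=
  match u with
  | GenTree.Node 0 [::] => Some Leaf
  | GenTree.Node 1 [:: a; b] =>
      if (tree_decode a, tree_decode b) is (Some l, Some r)
      then Some (Node l r) else None
  | _ => None
  end.

Lemma tree_encodeK : pcancel tree_encode tree_decode.
Proof. by elim=> //= l -> r ->. Qed.

HB.instance Definition _ := Countable.copy tree (pcan_type tree_encodeK).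

Fixpoint nodes (t : tree) : nat :=
  if t is Node l r then (nodes l + nodes r).+1 else 0.

Fixpoint leaves (t : tree) : nat :=
  if t is Node l r then (leaves l + leaves r)%N else 1.

Lemma leavesE t : leaves t = (nodes t).+1.
Proof. by elim: t => //= l -> r ->; rewrite addSn addnS. Qed.

Record Y (m : nat) := MkY { ytree :> tree; ytreeP : nodes ytree == m }.

HB.instance Definition _ m := [isSub for @ytree m].
HB.instance Definition _ m := [Countable of Y m by <:].

Fixpoint trees_upto (h : nat) : seq tree :=
  if h is h'.+1 then
    Leaf :: [seq Node l r | l <- trees_upto h', r <- trees_upto h']
  else [:: Leaf].

Lemma mem_trees_upto h t : (nodes t <= h)%N -> t \in trees_upto h.
Proof.
elim: h t => [|h IHh] [|l r] //=; rewrite ltnS => le_h.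
rewrite inE; apply/orP; right; apply/allpairsP; exists (l, r); split=> //=.
  by apply: IHh; apply: leq_trans le_h; apply: leq_addr.
by apply: IHh; apply: leq_trans le_h; apply: leq_addl.
Qed.

Definition Y_enum m : seq (Y m) := undup (pmap insub (trees_upto m)).

Lemma Y_enumP m : Finite.axiom (Y_enum m).
Proof.
apply: Finite.uniq_enumP; first exact: undup_uniq.
move=> t; rewrite mem_undup mem_pmap_sub !inE.
by apply: mem_trees_upto; rewrite (eqP (ytreeP t)).
Qed.

HB.instance Definition _ m := isFinite.Build (Y m) (@Y_enumP m).

(* [rotation s t]: t is obtained from s by replacing one subtree ((a b) c)
   by (a (b c)). *)
Fixpoint rotation (s t : tree) : bool :=
  if (s, t) is (Node l r, Node l' r') then
    [|| (if l is Node a b then (l' == a) && (r' == Node b r) else false),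
        rotation l l' && (r == r')
      | (l == l') && rotation r r']
  else false.

Definition tamari m : rel (Y m) := connect (fun s t : Y m => rotation s t).

(* Sum over the internal nodes of the size of their left subtree; it strictly
   decreases along rotations, whence antisymmetry. *)
Fixpoint left_weight (t : tree) : nat :=
  if t is Node l r then (nodes l + left_weight l + left_weight r)%N else 0.

Lemma rotation_weight s t :
  rotation s t -> nodes s = nodes t /\ (left_weight t < left_weight s)%N.
Proof.
elim: s t => [|l IHl r IHr] [|l' r'] //= /or3P[|/andP[h /eqP<-]|/andP[/eqP<- h]].
- case: l {IHl} => // a b /andP[/eqP-> /eqP->] /=; split.
    by rewrite addSn addnS -addnA.
  rewrite !addSn ltnS -!addnA; apply: leq_trans (leq_addl (nodes a) _).
  by rewrite (addnCA (nodes b) (nodes a)) (addnCA (nodes b) (left_weight a)).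
- by have [-> lt] := IHl _ h; split=> //; rewrite ltn_add2r ltn_add2l.
- by have [-> lt] := IHr _ h; split=> //; rewrite ltn_add2l.
Qed.

Lemma tamari_weight m (s t : Y m) :
  tamari s t -> s = t \/ (left_weight t < left_weight s)%N.
Proof.
case/connectP=> p; elim: p s => [|u p IHp] s /=; first by left.
case/andP=> /rotation_weight[_ lt_us] pth def_t; right.
by case: (IHp u pth def_t) => [<- // | lt_tu]; apply: ltn_trans lt_us.
Qed.

Lemma tamari_anti m : antisymmetric (@tamari m).
Proof.
move=> s t /andP[/tamari_weight[// | lt_ts] /tamari_weight[// | lt_st]].
by have := ltn_trans lt_ts lt_st; rewrite ltnn.
Qed.

Fact tamari_display : Order.disp_t. Proof. exact: Order.Disp tt tt. Qed.

HB.instance Definition _ m :=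
  Order.Le_isPOrder.Build tamari_display (Y m)
    (@connect0 _ _) (@tamari_anti m) (@connect_trans _ _).

(* [node_le t i j]: in t, the node numbered j lies on the path from the node
   numbered i to the root.  Nodes are numbered in in-order, from 0, so that the
   root of [Node l r] has number [nodes l]. *)
Fixpoint node_le (t : tree) (i j : nat) : bool :=
  if t is Node l r then
    let k := nodes l in
    [|| (j == k) && (i < nodes t)%N,
        [&& (i < k)%N, (j < k)%N & node_le l i j]
      | [&& (k < i)%N, (k < j)%N & node_le r (i - k.+1) (j - k.+1)]]
  else false.

Definition upper_ideal m (t : tree) (P : {set 'I_m}) : bool :=
  [forall i in P, forall j : 'I_m, node_le t i j ==> (j \in P)].

(* The set M_n of painted trees with n leaves.  The condition on the number of
   leaves follows from [ptree : Y n.-1] if 0 < n; it makes [M 0] empty. *)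
Record M (n : nat) := MkM {
  mval : Y n.-1 * {set 'I_n.-1};
  mvalP : (leaves mval.1 == n) && upper_ideal mval.1 mval.2 }.

HB.instance Definition _ n := [isSub for @mval n].
HB.instance Definition _ n := [Finite of M n by <:].

Definition ptree n (p : M n) : Y n.-1 := (mval p).1.
Definition painted n (p : M n) : {set 'I_n.-1} := (mval p).2.

Definition painted_le n : rel (M n) :=
  fun p q => (ptree p <= ptree q) && (painted q \subset painted p).

Lemma painted_le_refl n : reflexive (@painted_le n).
Proof. by move=> p; rewrite /painted_le lexx subxx. Qed.

Lemma painted_le_anti n : antisymmetric (@painted_le n).
Proof.
move=> p q /andP[/andP[le_pq sub_qp] /andP[le_qp sub_pq]]; apply: val_inj => /=.
rewrite [mval p]surjective_pairing [mval q]surjective_pairing.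
congr (_, _); first by apply/le_anti; rewrite le_pq.
by apply/eqP; rewrite eqEsubset sub_pq.
Qed.

Lemma painted_le_trans n : transitive (@painted_le n).
Proof.
move=> q p r /andP[le_pq sub_qp] /andP[le_qr sub_rq].
by rewrite /painted_le (le_trans le_pq le_qr) (subset_trans sub_rq sub_qp).
Qed.

Fact painted_display : Order.disp_t. Proof. exact: Order.Disp tt tt. Qed.

HB.instance Definition _ n :=
  Order.Le_isPOrder.Build painted_display (M n)
    (@painted_le_refl n) (@painted_le_anti n) (@painted_le_trans n).

(* [forest_above P o t]: the forest left above the painted portion when t is a
   subtree of the whole tree whose nodes are numbered from o onwards and P is
   the (upwards closed) set of numbers of the painted nodes. *)
Fixpoint forest_above (P : pred nat) (o : nat) (t : tree) : seq tree :=
  if t is Node l r then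
    if P (o + nodes l)%N
    then forest_above P o l ++ forest_above P (o + (nodes l).+1)%N r
    else [:: t]
  else [:: Leaf].

Definition unpainted_forest n (p : M n) : seq tree :=
  forest_above [pred i | i \in [seq val j | j in painted p]] 0 (ptree p).

(* (f_1, ..., f_k) |-> (...((| f_1) f_2)...f_k) *)
Definition graft_left (fs : seq tree) : tree := foldl Node Leaf fs.

Lemma leaves_forest_above P o t :
  sumn [seq leaves f | f <- forest_above P o t] = leaves t.
Proof.
elim: t o => //= l IHl r IHr o; case: ifP => _; last by rewrite /= addn0.
by rewrite map_cat sumn_cat IHl IHr.
Qed.

Lemma nodes_graft_left fs :
  nodes (graft_left fs) = sumn [seq leaves f | f <- fs].
Proof.
rewrite /graft_left -[RHS]add0n -[X in (X + _)%N]/(nodes Leaf).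
elim: fs Leaf => [|f fs IHfs] t /=; first by rewrite addn0.
by rewrite IHfs /= leavesE addnA addnS.
Qed.

Lemma gamma_subproof n (p : M n) : nodes (graft_left (unpainted_forest p)) == n.
Proof.
rewrite nodes_graft_left leaves_forest_above.
by have /andP[] := mvalP p.
Qed.

Definition gamma n (p : M n) : Y n := MkY (gamma_subproof p).

Definition is_join d (P : porderType d) (x y z : P) : Prop :=
  [/\ x <= z, y <= z & forall w, x <= w -> y <= w -> z <= w].

Definition is_meet d (P : porderType d) (x y z : P) : Prop :=
  [/\ z <= x, z <= y & forall w, w <= x -> w <= y -> w <= z].

Definition is_lattice d (P : porderType d) : Prop :=
  forall x y : P, (exists z, is_join x y z) /\ (exists z, is_meet x y z).

Definition is_interval d (P : finPOrderType d) (A : {set P}) : Prop :=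
  exists a b : P, A = [set x | a <= x <= b].

Record interval_retract d d' (P : finPOrderType d) (Q : porderType d')
    (f : P -> Q) : Prop := {
  retract_lattice : is_lattice P;
  retract_homo : {homo f : x y / x <= y};
  retract_surj : forall q, exists p, f p = q;
  retract_fiber : forall q, is_interval [set p | f p == q];
  retract_section : exists2 g : Q -> P, {homo g : x y / x <= y} & cancel g f }.

(* Main.v *)
Require Import Defs.
From mathcomp Require Import all_boot all_order.
From mathcomp Require Import zify.

(** Write [i -> j] when node [j] lies in the right subtree of node [i] (this is
    [rdesc t i j]). A tree is determined by this relation, the relations that
    occur are exactly the transitive ones where [i -> j] implies [i < j] and
    where [i -> k] and [i < j <= k] imply [i -> j] ([tree_of_right_rel]), and
    the Tamari order is inclusion of relations ([tamariP]): a rotation adds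
    pairs, and conversely a tree with a larger relation is reached by induction,
    once inverse rotations have made the root of the smaller tree the root of
    the larger one as well. So a painted tree becomes a pair of a relation and a
    set of nodes, ordered by inclusion of the relations and reverse inclusion of
    the sets, and all of the theorem can be read off in these coordinates.

    The map: number the nodes of [gamma p] so that the bottom of the limb is
    [-1] and node [i] of [p] stays [i] (painted nodes become the other nodes of
    the limb). Then [i -> j] in [gamma p] if and only if [i -> j] in [p] and
    there is no painted node in [(i, j]], where [-1 -> j] counts as true in [p]
    ([rdesc_gamma], with all numbers raised by one). This is monotone in the
    relation of [p] and antitone in its painted set, so [gamma] preserves the
    order.

    The fibres: the painted set of [p] can be recovered from [y = gamma p] as
    its limb, and then the relation of [p] must contain that of [y] and may
    differ from it only at painted [i] ([gamma_fibreP]). The least choice is the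
    relation of [y] (the painted nodes form a left comb), the greatest relates
    painted nodes to everything on their right (a right comb). Anything between
    the two is in the fibre because [gamma] is monotone. The least elements
    depend monotonically on [y], hence give the section.

    The lattice: intersecting two relations gives the meet of the trees. In this
    meet a node may have new ancestors to its right; closing the union of the
    painted sets under these gives the meet of the painted trees ([M_meet]). As
    there is also a greatest painted tree, joins exist by finiteness. *)

Set Implicit Arguments.
Unset Strict Implicit.
Unset Printing Implicit Defensive.

Import Order.TTheory.

(** * Right descendants *)

Definition rdesc (t : tree) : rel nat := fun i j => (i < j) && node_le t j i.

Lemma node_le_bound t i j : node_le t i j -> (i < nodes t) && (j < nodes t).
Proof.
elim: t i j => //= l IHl r IHr i j.
case/or3P=> [||/and3P[? ? /IHr]]; try lia.
Qed.

Lemma rdesc_bound t i j : rdesc t i j -> i < j < nodes t.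
Proof. by case/andP=> -> /node_le_bound/andP[]. Qed.

Ltac rdesc_lia :=
  intros; repeat match goal with
                 | |- context [rdesc ?t ?i ?j] => case: (rdesc t i j)
                 end; lia.

Lemma rdesc_Leaf i j : rdesc Leaf i j = false.
Proof. exact: andbF. Qed.

Lemma rdesc_Node l r i j : rdesc (Node l r) i j =
  [|| rdesc l i j, (i == nodes l) && (i < j < nodes (Node l r))
    | (nodes l < i) && rdesc r (i - (nodes l).+1) (j - (nodes l).+1)].
Proof.
apply/idP/idP; rewrite /rdesc /=.
  case/andP=> lt_ij /or3P[/andP[-> ->]|/and3P[_ _ ->]|/and3P[kj ki ->]].
  - by rewrite lt_ij orbT.
  - by rewrite lt_ij.
  - by rewrite ki (_ : i - _ < j - _) ?orbT //; lia.
case/or3P=> [/andP[lt_ij le_ji]|/and3P[/eqP-> -> ->]|/and3P[gt_i lt_ij ->]].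
- have /andP[? ?] := node_le_bound le_ji.
  by rewrite lt_ij; apply/or3P/Or32/and3P.
- by rewrite eqxx.
- by rewrite gt_i; lia.
Qed.

Lemma rdesc_convex t i j k : i < j <= k -> rdesc t i k -> rdesc t i j.
Proof.
elim: t i j k => [|l IHl r IHr] i j k lt_ijk; first by rewrite rdesc_Leaf.
rewrite !rdesc_Node /=.
case/or3P=> [/(IHl _ _ _ lt_ijk)->//||/andP[li rik]]; first by rdesc_lia.
by rewrite li (IHr _ _ _ _ rik) ?orbT //; have := rdesc_bound rik; rdesc_lia.
Qed.

Lemma rdesc_trans t : transitive (rdesc t).
Proof.
elim: t => [|l IHl r IHr] j i k; first by rewrite rdesc_Leaf.
rewrite !rdesc_Node /=.
case/or3P=> [lij|/andP[/eqP-> ij]|/andP[li rij]].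
- have := rdesc_bound lij => bij.
  by case/or3P=> [/(IHl _ _ _ lij)->//||]; rdesc_lia.
- case/or3P=> [/rdesc_bound||/andP[_ /rdesc_bound]]; rdesc_lia.
- have := rdesc_bound rij => bij.
  case/or3P=> [/rdesc_bound||/andP[_ /(IHr _ _ _ rij)->]]; rdesc_lia.
Qed.

Definition free (Q : pred nat) i j := all (predC Q) (index_iota i j).

Lemma freeP (Q : pred nat) i j :
  reflect (forall k, i <= k < j -> ~~ Q k) (free Q i j).
Proof.
by apply: (iffP allP) => H k kij; apply: H; move: kij; rewrite mem_index_iota.
Qed.

(** [climbs (rdesc t) i j]: for [i < j], node [j] is an ancestor of [i] on its
    right. *)
Definition climbs (D : rel nat) i j := free (D^~ j) i j.

Lemma climbsP (D : rel nat) i j :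
  reflect (forall k, i <= k < j -> ~~ D k j) (climbs D i j).
Proof. exact: freeP. Qed.

(** The left subtree of [j] is the longest run of nodes ending just before [j]
    in which no node has [j] in its right subtree. Hence the ancestors to the
    right are determined by [rdesc] as well. *)
Lemma node_le_climbs t i j :
  i < j < nodes t -> node_le t i j = climbs (rdesc t) i j.
Proof.
elim: t i j => [|l IHl r IHr] i j; first by rewrite andbF.
case/andP=> /= lt_ij lt_j.
have [lt_jl|gt_jl|eq_jl] := ltngtP j (nodes l).
- rewrite (_ : i < nodes l) /=; last by lia.
  rewrite andbF orbF IHl ?lt_ij //; apply/climbsP/climbsP=> H k ikj.
    by rewrite rdesc_Node /= !negb_or H //=; rdesc_lia.
  by have := H k ikj; rewrite rdesc_Node negb_or => /andP[].
- have [lt_il|ge_il] := leqP i (nodes l); last first.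
    rewrite IHr /=; last by rdesc_lia.
    rewrite ltnNge (ltnW ge_il) /=.
    apply/climbsP/climbsP=> H k ikj.
      apply/negP; rewrite rdesc_Node => /or3P[/rdesc_bound||/andP[_]].
      1,2: by rdesc_lia.
      by apply/negP/H; lia.
    apply/negP=> rkj; have /negP[] := H (nodes l + k.+1) ltac:(lia).
    rewrite rdesc_Node (_ : _ - _ = k); last by lia.
    by rewrite rkj (_ : _ < _ + _) ?orbT //; lia.
  rewrite andbF /=; symmetry; apply/negP=> /climbsP/(_ (nodes l)).
  rewrite lt_il gt_jl => /(_ isT).
  by rewrite rdesc_Node eqxx gt_jl /= lt_j orbT.
- rewrite (_ : i < (_ + _).+1) /=; last by lia.
  symmetry; apply/climbsP=> k kj.
  by apply/negP; rewrite rdesc_Node => /or3P[/rdesc_bound||]; rdesc_lia.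
Qed.

(** * The Tamari order *)

Inductive rotates : tree -> tree -> Prop :=
| Rotates0 t : rotates t t
| RotatesS s t u : rotation s t -> rotates t u -> rotates s u.

Lemma rotates_trans s t u : rotates s t -> rotates t u -> rotates s u.
Proof.
by elim=> // {}s {}t v st _ IH /IH; apply: RotatesS.
Qed.

Lemma rotates_nodes s t : rotates s t -> nodes s = nodes t.
Proof. by elim=> // {}s {}t u /rotation_weight[-> _]. Qed.

Lemma rotates_NodeL l l' r : rotates l l' -> rotates (Node l r) (Node l' r).
Proof.
elim=> [t|{}l m {}l' lm _]; first exact: Rotates0.
by apply: RotatesS; rewrite /= lm eqxx orbT.
Qed.

Lemma rotates_NodeR l r r' : rotates r r' -> rotates (Node l r) (Node l r').
Proof.
elim=> [t|{}r m {}r' rm _]; first exact: Rotates0.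
by apply: RotatesS; rewrite /= rm eqxx !orbT.
Qed.

Lemma rotation_rdesc s t i j : rotation s t -> rdesc s i j -> rdesc t i j.
Proof.
elim: s t i j => [|l IHl r IHr] [|l' r'] // i j.
move=> /or3P[|/andP[rl /eqP<-]|/andP[/eqP<- rr]].
- case: l {IHl} => // a b /andP[/eqP-> /eqP->].
  rewrite !rdesc_Node /= => H.
  case/orP: H => [/or3P[->//||/andP[-> bij]]|]; try by rdesc_lia.
  - by rewrite bij !orbT.
  case/orP=> [|/andP[gt_i rij]]; first by rdesc_lia.
  rewrite (_ : i - (nodes a).+1 - _ = i - (nodes a + nodes b).+2); last by rdesc_lia.
  rewrite (_ : j - (nodes a).+1 - _ = j - (nodes a + nodes b).+2); last by rdesc_lia.
  by rewrite rij; rdesc_lia.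
- have [eq_n _] := rotation_weight rl.
  rewrite !rdesc_Node /= eq_n => /or3P[/(IHl _ _ _ rl)->//|->|->];
    by rewrite ?orbT.
- have [eq_n _] := rotation_weight rr.
  rewrite !rdesc_Node /= eq_n => /or3P[->//|->|/andP[-> /(IHr _ _ _ rr)->]];
    by rewrite ?orbT.
Qed.

(** A node [k] whose right subtree contains everything after it is on the right
    spine of [t]. Undoing rotations moves it up along the spine to the root;
    this cuts the right subtrees of the nodes before [k] off at [k], and changes
    no other right subtree. *)
Lemma right_spine_split t k :
  k < nodes t -> (forall j, k < j < nodes t -> rdesc t k j) ->
  exists u v, [/\ nodes u = k, rotates (Node u v) t,
    forall i j, j < k -> rdesc t i j -> rdesc u i j
  & forall i j, rdesc t (k.+1 + i) (k.+1 + j) -> rdesc v i j].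
Proof.
elim: t k => // l IHl r IHr k lt_k spine.
have [lt_kl|gt_kl|->] := ltngtP k (nodes l).
- have := spine (nodes l); rewrite rdesc_Node.
  move=> H; have /or3P[/rdesc_bound||] : _ := H ltac:(simpl; lia); rdesc_lia.
- rewrite /= in lt_k.
  have [||u [v [nu rot Hu Hv]]] := IHr (k - (nodes l).+1); first by rdesc_lia.
    move=> j ltj; have := spine (nodes l + j.+1).
    rewrite rdesc_Node /= (_ : nodes l + _ - _ = j); last by rdesc_lia.
    move=> H; have /or3P[/rdesc_bound||/andP[]//] : _ := H ltac:(lia); rdesc_lia.
  exists (Node l u), v; split.
  - by rewrite /= nu; rdesc_lia.
  - apply: RotatesS (rotates_NodeR l rot); by rewrite /= !eqxx.
  - move=> i j jk; rewrite !rdesc_Node /= nu.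
    case/or3P=> [->//||/andP[li rij]]; first by rdesc_lia.
    by rewrite li Hu ?orbT //; have := rdesc_bound rij; lia.
  - move=> i j; rewrite rdesc_Node => /or3P[/rdesc_bound||/andP[_ rij]].
    1,2: by rdesc_lia.
    by apply: Hv; move: rij; congr rdesc; rdesc_lia.
- exists l, r; split=> //; first exact: Rotates0.
    move=> i j jl; rewrite rdesc_Node => /or3P[//||/andP[? /rdesc_bound]]; rdesc_lia.
  move=> i j; rewrite rdesc_Node => /or3P[/rdesc_bound||/andP[_]]; try rdesc_lia.
  by congr rdesc; rdesc_lia.
Qed.

(** The root of [s] has all later nodes as right descendants, in [t] too; so
    [right_spine_split] applies to it in [t] and yields, below [t], a tree with
    the same root as [s]. The two pairs of subtrees are compared by induction:
    right descendants in the left subtree of [s] come before its root, so they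
    survive the cut. *)
Lemma rdesc_rotates s t : nodes s = nodes t ->
  (forall i j, rdesc s i j -> rdesc t i j) -> rotates s t.
Proof.
elim: s t => [|l IHl r IHr] t eq_n sub_st.
  by case: t eq_n {sub_st} => //; left.
rewrite /= in eq_n.
have [||u [v [nu rot Hu Hv]]] := @right_spine_split t (nodes l).
- by rdesc_lia.
- by move=> j ltj; apply: sub_st; rewrite rdesc_Node eqxx /= eq_n ltj orbT.
have nv : nodes v = nodes r by have /= := rotates_nodes rot; rdesc_lia.
apply: rotates_trans rot; apply: (@rotates_trans _ (Node u r)).
  apply/rotates_NodeL/IHl => // i j lij; apply: Hu.
    by have := rdesc_bound lij; rdesc_lia.
  by apply: sub_st; rewrite rdesc_Node lij.
apply/rotates_NodeR/IHr => // i j rij; apply: Hv.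
apply: sub_st; rewrite rdesc_Node !addSn !subSS !addKn rij.
by rewrite ltnS leq_addr !orbT.
Qed.

Lemma tamariP m (s t : Y m) :
  reflect (forall i j, rdesc s i j -> rdesc t i j) (s <= t)%O.
Proof.
apply: (iffP idP) => [/connectP[p] | sub_st].
  elim: p s => [|u p IHp] s /=; first by move=> _ ->.
  by case/andP=> su pth def_t i j /(rotation_rdesc su); apply: IHp.
have: rotates s t.
  by apply: rdesc_rotates sub_st; rewrite (eqP (ytreeP s)) (eqP (ytreeP t)).
move def_s: (ytree s) => s'; move def_t: (ytree t) => t' rot.
elim: rot s t def_s def_t {sub_st} => {s' t'} [u|s' u t' su _ IH] s t def_s def_t.
  by rewrite (_ : s = t) //; apply: val_inj; rewrite /= def_s.
have nu : nodes u == m.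
  by have [<- _] := rotation_weight su; rewrite -def_s ytreeP.
apply: le_trans (IH (MkY nu) t _ _) => //.
by apply: connect1; rewrite /= def_s.
Qed.

(** * Relations that come from trees *)

(** The relations that arise as [rdesc t] for a tree [t] with [m] nodes. *)
Record right_rel m (D : rel nat) : Prop := RightRel {
  right_bound : forall i j, D i j -> i < j < m;
  right_convex : forall i j k, i < j <= k -> D i k -> D i j;
  right_trans : transitive D }.

Lemma rdesc_right_rel t : right_rel (nodes t) (rdesc t).
Proof.
split; [exact: rdesc_bound|exact: rdesc_convex|exact: rdesc_trans].
Qed.

(** The root must be the first node related to all later ones (the last node is
    such a node). No earlier node is related to it, for by transitivity and
    convexity that node would be related to all later ones too, so the relation
    splits into the parts before and after the root. *)
Lemma tree_of_right_rel m D : right_rel m D ->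
  exists2 t, nodes t = m & forall i j, rdesc t i j = D i j.
Proof.
elim/ltn_ind: m D => -[|m] IH D [bndD cvxD trD].
  exists Leaf => // i j; rewrite rdesc_Leaf; symmetry; apply/negP=> /bndD; lia.
(* The candidates for the root; the least one is taken below. *)
pose root k := (k <= m) && [forall j : 'I_m.+1, (k < j) ==> D k j].
have ex_root : exists k, root k.
  exists m; rewrite /root leqnn; apply/forallP=> j; apply/implyP.
  by have := ltn_ord j; lia.
case: (ex_minnP ex_root) => k /andP[le_k /forallP root_k] min_k.
have Dk j : k < j <= m -> D k j.
  case/andP=> kj jm; exact: (implyP (root_k (Ordinal (jm : j < m.+1)))).
have Dlt i j : i < k <= j -> D i j = false.
  case/andP=> ik kj; apply/negP=> Dij.
  suff /min_k : root i by lia.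
  have Dik : D i k by apply: cvxD Dij; lia.
  apply/andP; split; first by lia.
  apply/forallP=> h; apply/implyP=> ih.
  have [hk|kh] := leqP h k; first by apply: cvxD Dik; lia.
  by apply: trD Dik _; apply: Dk; have := ltn_ord h; lia.
have [||l nl Dl] := IH k _ (fun i j => D i j && (j < k)); first by lia.
  split=> [i j /andP[/bndD]|i j h ijh /andP[/(cvxD _ _ _ ijh)-> ]|j i h]; try lia.
  by case/andP=> Dij _ /andP[/(trD _ _ _ Dij)->].
have [||r nr Dr] := IH (m - k) _ (fun i j => D (k.+1 + i) (k.+1 + j)); first by lia.
  split=> [i j /bndD|i j h ijh|j i h]; try lia.
    by apply: cvxD; lia.
  exact: trD.
exists (Node l r) => [|i j]; first by rewrite /= nl nr; lia.
rewrite rdesc_Node /= Dl Dr nl nr.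
have [ik|ki|->] := ltngtP i k; rewrite ?andbF ?orbF /=.
- by have [kj|kj] := ltnP j k; rewrite ?andbT // andbF Dlt // ik.
- have [ij|ji] := ltnP i j; last first.
    rewrite (_ : D i j = false); last by apply/negP=> /bndD; lia.
    by apply/negP=> /= /bndD; lia.
  rewrite (_ : (j < k) = false) ?andbF /=; last by lia.
  by congr D; lia.
- rewrite addnC; apply/idP/idP=> [/orP[/andP[]//|]|Dkj].
    by move=> ?; apply: Dk; lia.
  by have := bndD _ _ Dkj; lia.
Qed.

(** * The image of a forest *)

Lemma nodes_foldl acc fs :
  nodes (foldl Node acc fs) = nodes acc + sumn [seq leaves f | f <- fs].
Proof.
elim: fs acc => [|f fs IH] acc /=; first by rewrite addn0.
by rewrite IH /= leavesE addnA addnS.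
Qed.

Lemma rdesc_foldl_left acc fs i j :
  i < nodes acc -> rdesc (foldl Node acc fs) i j = rdesc acc i j.
Proof.
elim: fs acc => //= f fs IH acc lt_i; rewrite IH /=; last by lia.
rewrite rdesc_Node.
by case: (rdesc acc i j) => //=; apply/negP=> /orP[]; rdesc_lia.
Qed.

(** Positions counted from the new root of [Node acc t]: the root is [0] and
    node [i] of [t] is [i.+1]. *)
Lemma rdesc_limb acc t i j :
  rdesc (Node acc t) (nodes acc + i) (nodes acc + j) =
    (i < j <= nodes t) && ((0 < i) ==> rdesc t i.-1 j.-1).
Proof.
rewrite rdesc_Node /=.
have -> : rdesc acc (nodes acc + i) (nodes acc + j) = false.
  by apply/negP=> /rdesc_bound; lia.
case: i => [|i] /=; first by rewrite addn0 eqxx ltnn /=; lia.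
rewrite (_ : _ == _ = false) /=; last by lia.
rewrite (_ : nodes acc < _); last by lia.
rewrite (_ : _ - _ = i) /=; last by lia.
rewrite (_ : _ - _ = j.-1) /=; last by lia.
by apply/idP/andP=> [rij|[]//]; split=> //; have := rdesc_bound rij; lia.
Qed.

(** Positions are again counted from the first new node. Each tree of the forest
    is the right subtree of the limb node before it, and this limb node sits
    where the painted node separating it from the preceding tree was; so a limb
    node has as right descendants the nodes up to the next painted one, and an
    unpainted node keeps its own, among which none is painted. Since right
    descendants of a painted node that precede the next painted node are all the
    nodes in between, one formula covers both. For the induction [t] may be a
    subtree that starts at node [o] of the whole tree. *)
Lemma rdesc_foldl_forest (P : pred nat) o t acc i j :
  (forall x y, node_le t x y -> P (o + x) -> P (o + y)) ->
  rdesc (foldl Node acc (forest_above P o t)) (nodes acc + i) (nodes acc + j) =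
    [&& i < j <= nodes t, (0 < i) ==> rdesc t i.-1 j.-1
      & free (fun x => P (o + x)) i j].
Proof.
elim: t o acc i j => [|l IHl r IHr] o acc i j upP.
  rewrite [forest_above _ _ _]/= [foldl _ _ _]/= rdesc_limb.
  by rewrite (_ : i < j <= _ = false) //=; lia.
have upl x y : node_le l x y -> P (o + x) -> P (o + y).
  move=> le_xy; apply: upP => /=.
  by have /andP[-> ->] := node_le_bound le_xy; rewrite le_xy orbT.
have upr x y : node_le r x y -> P (o + (nodes l).+1 + x) ->
    P (o + (nodes l).+1 + y).
  rewrite -!addnA => le_xy; apply: upP => /=.
  rewrite !(addKn, leq_addr, addSn, ltnS) !subSS !addKn le_xy; lia.
set t := Node l r; rewrite /=; case: ifP => [Pk|nPk]; last first.
  rewrite [foldl _ _ _]/= rdesc_limb andbA -[LHS]andbT; apply/andb_id2l.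
  case/andP=> lt_ij _; symmetry; apply/freeP=> x ltx; apply/negP=> Px.
  move: nPk; rewrite (upP x) //= eqxx.
  by rewrite (_ : x < _) //; simpl in lt_ij; lia.
rewrite foldl_cat; set acc1 := foldl Node acc _.
have n1 : nodes acc1 = nodes acc + (nodes l).+1.
  by rewrite /acc1 nodes_foldl leaves_forest_above leavesE.
have [le_il|gt_il] := leqP i (nodes l).
  rewrite rdesc_foldl_left ?n1; last by lia.
  rewrite IHl //; have [le_jl|gt_jl] := leqP j (nodes l).
    congr [&& _, _ & _]; first by rewrite /=; lia.
    case: i le_il => // i le_il; rewrite rdesc_Node /=.
    case: (rdesc l i j.-1) => //=; symmetry; apply/negP=> /orP[]; rdesc_lia.
  rewrite andbF /=; symmetry; apply/negP=> /and3P[_ _ /freeP/(_ (nodes l))].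
  by rewrite Pk le_il gt_jl => /(_ isT).
have [lt_ij|le_ji] : i < j \/ j <= i by lia.
  2: by rewrite [in RHS]ltnNge le_ji; apply/negP=> /rdesc_bound; lia.
rewrite (_ : nodes acc + i = nodes acc1 + (i - (nodes l).+1)); last by lia.
rewrite (_ : nodes acc + j = nodes acc1 + (j - (nodes l).+1)); last by lia.
rewrite IHr // (_ : _ < _ <= _ = (i < j <= nodes t)); last by rewrite /=; lia.
apply/andb_id2l=> /= bnd_ij; congr (_ && _).
- rewrite (_ : 0 < i) /=; last by lia.
  rewrite rdesc_Node /=.
  rewrite (_ : rdesc l _ _ = false) /=; last by apply/negP=> /rdesc_bound; lia.
  have [eq_i|ne_i] := eqVneq i (nodes l).+1; first by rewrite eq_i subnn eqxx; lia.
  rewrite (_ : _ == _ = false) /=; last by lia.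
  rewrite (_ : 0 < i - _) /=; last by lia.
  rewrite (_ : nodes l < _) /=; last by lia.
  by congr rdesc; lia.
- apply/freeP/freeP=> H k ltk.
    rewrite -(subnKC (_ : nodes l < k)) 1?addnA; last by lia.
    by apply: H; lia.
  by rewrite -addnA; apply: H; lia.
Qed.

(** * Painted trees in coordinates *)

Definition is_painted n (p : M n) : pred nat :=
  [pred i | i \in [seq val j | j in painted p]].

Lemma is_paintedE n (p : M n) (i : 'I_n.-1) : is_painted p i = (i \in painted p).
Proof. by rewrite /is_painted /= mem_map ?mem_enum //; apply: val_inj. Qed.

Lemma is_painted_ord n (p : M n) i :
  is_painted p i -> exists2 j : 'I_n.-1, i = j & j \in painted p.
Proof. by case/mapP=> j; rewrite mem_enum; exists j. Qed.

Lemma nodes_ptree n (p : M n) : nodes (ptree p) = n.-1.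
Proof. exact/eqP/ytreeP. Qed.

Lemma M_gt0 n (p : M n) : 0 < n.
Proof. by have /andP[/eqP + _] := mvalP p; rewrite leavesE; lia. Qed.

(** Upper order ideals in terms of right descendants: ancestors to the left are
    given by [D], ancestors to the right by [climbs D]. *)
Record painting m (D : rel nat) (P : pred nat) : Prop := Painting {
  painting_bound : forall i, P i -> i < m;
  painting_left : forall i j, D i j -> P j -> P i;
  painting_right : forall i j, i < j < m -> climbs D i j -> P i -> P j }.

Lemma painted_up n (p : M n) i j :
  node_le (ptree p) i j -> is_painted p i -> is_painted p j.
Proof.
move=> le_ij /is_painted_ord[i' def_i i'P]; rewrite {i}def_i in le_ij.
have /andP[_] := node_le_bound le_ij; rewrite nodes_ptree => lt_j.
rewrite (is_paintedE p (Ordinal lt_j)).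
have /andP[_ /forall_inP/(_ i' i'P)/forallP/(_ (Ordinal lt_j))/implyP] := mvalP p.
exact.
Qed.

Lemma paintingP n (p : M n) : painting n.-1 (rdesc (ptree p)) (is_painted p).
Proof.
split=> [i /is_painted_ord[j -> _] //|i j /andP[_]|i j]; first exact: painted_up.
move=> lt_ij climb; apply: painted_up.
by rewrite node_le_climbs ?nodes_ptree.
Qed.

Lemma M_of_painting n D P : 0 < n -> right_rel n.-1 D -> painting n.-1 D P ->
  exists p : M n, rdesc (ptree p) =2 D /\ is_painted p =1 P.
Proof.
move=> n_gt0 /tree_of_right_rel[t nt Dt] [bndP leftP rightP].
have Pt : nodes t == n.-1 by rewrite nt.
have upP : (leaves t == n) && upper_ideal t [set i : 'I_n.-1 | P i].
  rewrite leavesE nt prednK // eqxx; apply/forall_inP=> i; rewrite inE => Pi.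
  apply/forallP=> j; apply/implyP; rewrite inE => le_ij.
  have [lt_ij|lt_ji|<-//] := ltngtP (i : nat) j.
    apply: (rightP i) => //; first by rewrite lt_ij /=.
    move: le_ij; rewrite node_le_climbs; last by rewrite lt_ij nt /=.
    by move=> /climbsP H; apply/climbsP=> k ltk; rewrite -Dt H.
  by apply: (leftP j i) => //; rewrite -Dt /rdesc lt_ji.
exists (@MkM n (MkY Pt, [set i : 'I_n.-1 | P i]) upP); split=> // i.
apply/idP/idP=> [/is_painted_ord[j ->]|Pi]; first by rewrite inE.
by rewrite (is_paintedE _ (Ordinal (bndP i Pi))) inE.
Qed.

Lemma painted_leP n (p q : M n) :
  reflect ((forall i j, rdesc (ptree p) i j -> rdesc (ptree q) i j) /\
           (forall i, is_painted q i -> is_painted p i)) (p <= q)%O.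
Proof.
apply: (iffP andP) => -[/tamariP le_pq sub_qp]; split=> //.
  by move=> i /is_painted_ord[j -> /(subsetP sub_qp)]; rewrite is_paintedE.
by apply/subsetP=> j; rewrite -!is_paintedE; apply: sub_qp.
Qed.

(** Number [i] in [gamma p] is the bottom of the limb for [i = 0], and otherwise
    stands for node [i.-1] of [p]; likewise painted node [k] of [p] is limb node
    [k.+1], so [free] over the interval from [i] to [j] speaks of the nodes
    numbered [i.+1] to [j] of [gamma p]. *)
Lemma rdesc_gamma n (p : M n) i j :
  rdesc (gamma p) i j =
    [&& i < j < n, (0 < i) ==> rdesc (ptree p) i.-1 j.-1
      & free (is_painted p) i j].
Proof.
have := @rdesc_foldl_forest (is_painted p) 0 (ptree p) Leaf i j (@painted_up _ p).
rewrite /= !add0n => ->; rewrite nodes_ptree; congr (_ && _).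
by have := M_gt0 p; lia.
Qed.

Lemma gamma_homo n : {homo @gamma n : p q / (p <= q)%O}.
Proof.
move=> p q /painted_leP[sub_pq sub_qp]; apply/tamariP=> i j.
rewrite !rdesc_gamma => /and3P[-> /implyP Dij /freeP Pij] /=.
apply/andP; split; first by apply/implyP=> /Dij/sub_pq.
by apply/freeP=> k /Pij; apply/contra/sub_qp.
Qed.

(** * The lattice of painted trees *)

Lemma M_top n : 0 < n -> exists t : M n, forall p : M n, (p <= t)%O.
Proof.
move=> n_gt0.
have [||t [Dt Pt]] := @M_of_painting n (fun i j => i < j < n.-1) pred0 n_gt0.
- by split; move=> *; lia.
- by split.
exists t => p; apply/painted_leP; split=> [i j /rdesc_bound|i]; last by rewrite Pt.
by rewrite Dt nodes_ptree.
Qed.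

(** The painted set of the meet consists of the nodes that are reached from
    painted nodes of [p] or [q] by climbing to the right in the intersection [D]
    of the two relations. It is closed under ancestors to the left: if [j] is
    reached from a painted [i] and [a] has [j] as right descendant, then [a <
    i], as [i] would not climb to [j] past [a] otherwise; so [i] is a right
    descendant of [a] in both [p] and [q], and [a] is itself painted in one of
    them. It is contained in the painted set of any lower bound, where there are
    fewer right descendants and so more ancestors to the right. *)
Lemma M_meet n (p q : M n) : exists m, is_meet p q m.
Proof.
have [_ cvxp trp] := rdesc_right_rel (ptree p).
have [bndq cvxq trq] := rdesc_right_rel (ptree q).
have [bPp leftp _] := paintingP p; have [bPq leftq _] := paintingP q.
pose D i j := rdesc (ptree p) i j && rdesc (ptree q) i j.
pose P j := (j < n.-1) &&
  has (fun i => (is_painted p i || is_painted q i) && climbs D i j) (iota 0 j.+1).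
have PP i j : i <= j -> j < n.-1 -> is_painted p i || is_painted q i ->
    climbs D i j -> P j.
  move=> ij jn Pi Dij; rewrite /P jn; apply/hasP; exists i; last by rewrite Pi.
  by rewrite mem_iota; lia.
have climbs_refl i : climbs D i i by apply/climbsP; lia.
have [||m [Dm Pm]] := @M_of_painting n D P (M_gt0 p).
- split=> [i j /andP[_ /bndq]|i j k ijk /andP[pik qik]|j i k].
  + by rewrite nodes_ptree.
  + by rewrite /D (cvxp _ _ _ ijk) ?(cvxq _ _ _ ijk).
  + by move=> /andP[/trp tp /trq tq] /andP[/tp pik /tq qik]; apply/andP.
- split=> [i /andP[] //|i j /andP[pij qij] /andP[jn /hasP[k]]|i j ijn ci].
    rewrite mem_iota add0n => /= ltk /andP[Pk /climbsP ck].
    have bij := bndq _ _ qij.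
    have ik : i < k.
      rewrite ltnNge; apply/negP=> ki; have /negP[] := ck i ltac:(lia).
      exact/andP.
    apply: (PP i i) => //; first by lia.
    case/orP: Pk => Pk; first by rewrite (leftp _ _ (cvxp i k j _ pij) Pk) //; lia.
    by rewrite (leftq _ _ (cvxq i k j _ qij) Pk) ?orbT //; lia.
  case/andP=> _ /hasP[k]; rewrite mem_iota add0n => /= ltk /andP[Pk /climbsP ck].
  apply: (PP k) => //; try lia.
  apply/climbsP=> h lth; have [ih|hi] := leqP i h.
    by apply: (climbsP _ _ _ ci); lia.
  apply: contra (ck h ltac:(lia)) => /andP[phj qhj].
  by rewrite /D (cvxp h i j) ?(cvxq h i j) //; lia.
exists m; split.
- apply/painted_leP; split=> [i j|i Pi]; first by rewrite Dm => /andP[].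
  by rewrite Pm; apply: (PP i) => //; [apply: bPp | rewrite Pi].
- apply/painted_leP; split=> [i j|i Pi]; first by rewrite Dm => /andP[].
  by rewrite Pm; apply: (PP i) => //; [apply: bPq | rewrite Pi orbT].
move=> w /painted_leP[wp Pwp] /painted_leP[wq Pwq].
apply/painted_leP; split=> [i j Dij|j]; first by rewrite Dm /D wp ?wq.
rewrite Pm => /andP[jn /hasP[i]].
rewrite mem_iota add0n => /= lti /andP[Pi /climbsP ci].
have [_ _ rightw] := paintingP w.
have Pwi : is_painted w i by case/orP: Pi; [apply: Pwp | apply: Pwq].
have [->//|ne_ij] := eqVneq j i.
apply: rightw Pwi; first by lia.
apply/climbsP=> k /ci; apply: contra => wkj.
by rewrite /D wp ?wq.
Qed.

Lemma lattice_of_meets d (L : finPOrderType d) (t : L) :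
  (forall x, (x <= t)%O) -> (forall x y : L, exists z, is_meet x y z) ->
  is_lattice L.
Proof.
move=> le_t meetL x y; split; last exact: meetL.
have glb (s : seq L) : exists z, {in s, forall w, (z <= w)%O} /\
    (forall v, {in s, forall w, (v <= w)%O} -> (v <= z)%O).
  elim: s => [|w s [z [lbz glbz]]]; first by exists t.
  have [u [uw uz glbu]] := meetL w z; exists u; split=> [v|v lbv].
    by rewrite inE => /predU1P[-> //|/lbz]; apply: le_trans.
  apply: glbu; first by apply: lbv; rewrite mem_head.
  by apply: glbz => v' sv'; apply: lbv; rewrite inE sv' orbT.
have [z [lbz glbz]] := glb [seq w <- enum L | (x <= w)%O && (y <= w)%O].
exists z; split=> [||w xw yw].
- by apply: glbz => w; rewrite mem_filter => /andP[/andP[]].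
- by apply: glbz => w; rewrite mem_filter => /andP[/andP[]].
- by apply: lbz; rewrite mem_filter xw yw mem_enum.
Qed.

(** * The fibres *)

(** The left spine of [y] without its bottom node, which is number [0]. Numbers
    are those of the nodes of a painted tree, one less than in [y]. *)
Definition limb n (y : Y n) l := (l < n.-1) && climbs (rdesc y) 0 l.+1.

Lemma limbPn n (y : Y n) l : l < n.-1 ->
  reflect (exists2 i, i <= l & rdesc y i l.+1) (~~ limb y l).
Proof.
move=> lt_l; rewrite /limb lt_l /= /climbs /free -has_predC.
apply: (iffP hasP) => [[i]|[i il Dil]].
  by rewrite mem_index_iota /= negbK; exists i.
by exists i; rewrite ?mem_index_iota //= negbK.
Qed.

(** A painted node becomes a limb node. Conversely, an unpainted node [l] is a
    right descendant of the last painted node [i] before it: otherwise the first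
    later node that is not would be an ancestor of [i] to the right, hence
    painted, between [i] and [l]. So it is in the right subtree of the limb node
    that comes from [i], or of the bottom one if there is no such [i]. *)
Lemma limb_gamma n (p : M n) : limb (gamma p) =1 is_painted p.
Proof.
have [bP _ rightp] := paintingP p.
move=> l; have [lt_l|ge_l] := ltnP l n.-1; last first.
  by rewrite /limb ltnNge ge_l; symmetry; apply/negP=> /bP; lia.
apply: negb_inj; apply/limbPn/idP=> // [[i il]|nPl].
  by rewrite rdesc_gamma => /and3P[_ _ /freeP->//]; rewrite il /=.
suff [i [il Pi frl]] : exists i, [/\ i <= l, (0 < i) ==> is_painted p i.-1
    & forall k, i <= k <= l -> ~~ is_painted p k].
  exists i => //; rewrite rdesc_gamma; apply/and3P; split; first by lia.
    case: i il Pi frl => //= i il Pi frl.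
    apply/negPn/negP=> nDil.
    have ex_j : exists j, (i < j <= l) && ~~ rdesc (ptree p) i j.
      by exists l; rewrite il leqnn.
    case: (ex_minnP ex_j) => j /andP[/andP[ij jl] nDij] min_j.
    have /negP[] := frl j ltac:(lia); apply: rightp Pi; first by lia.
    apply/climbsP=> k ikj; apply/negP=> Dkj.
    have [eq_k|ne_k] := eqVneq k i; first by rewrite -eq_k Dkj in nDij.
    have Dik : rdesc (ptree p) i k.
      by apply/negPn/negP=> nDik; have := min_j k; rewrite nDik; lia.
    by rewrite (rdesc_trans Dik Dkj) in nDij.
  by apply/freeP=> k ltk; apply: frl.
(* [i] is one more than the last painted node before [l], or [0]. *)
have ex_i : exists i,
    (i <= l.+1) && [forall k : 'I_l.+1, (i <= k) ==> ~~ is_painted p k].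
  exists l.+1; rewrite leqnn; apply/forallP=> k; apply/implyP.
  by have := ltn_ord k; lia.
case: (ex_minnP ex_i) => i /andP[_ /forallP fri] min_i.
have frl k : i <= k <= l -> ~~ is_painted p k.
  by case/andP=> ik kl; apply: (implyP (fri (Ordinal (kl : k < l.+1)))).
have il : i <= l.
  apply: min_i; rewrite leqnSn; apply/forallP=> k; apply/implyP=> lk.
  by rewrite (_ : val k = l) //; apply/eqP; rewrite eqn_leq lk -ltnS ltn_ord.
exists i; split=> //; case: i fri min_i frl il => //= i _ min_i frl il.
apply/negPn/negP=> nPi; suff: i < i by rewrite ltnn.
apply: min_i; apply/andP; split; first by lia.
apply/forallP=> k; apply/implyP=> ik.
have [<-//|ne_ik] := eqVneq i (k : nat).
by apply: frl; have := ltn_ord k; lia.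
Qed.

(** In any [y], a limb node is followed by its right descendants up to the next
    limb node: the least node having [j] as right descendant is on the left
    spine, so it is [i]. *)
Lemma limb_gap n (y : Y n) i j :
  i < j < n -> (0 < i) ==> limb y i.-1 -> free (limb y) i j -> rdesc y i j.
Proof.
move=> ijn limb_i /freeP free_ij.
have [||a aj Daj] := @limbPn _ y j.-1 _ (free_ij _ _); try lia.
rewrite prednK in Daj; last by lia.
have ex_a : exists a, rdesc y a j by exists a.
case: (ex_minnP ex_a) => {aj Daj} a Daj min_a.
have baj := rdesc_bound Daj.
have [lt_ai|lt_ia|<-//] := ltngtP a i.
  move: limb_i; rewrite (_ : 0 < i) /=; last by lia.
  case/andP=> _ /climbsP/(_ a); rewrite prednK; last by lia.
  rewrite (rdesc_convex _ Daj) /=; last by lia.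
  by move=> H; have := H ltac:(lia).
have [||b ba Dba] := @limbPn _ y a.-1 _ (free_ij _ _); try lia.
rewrite prednK in Dba; last by lia.
by have := min_a b (rdesc_trans Dba Daj); lia.
Qed.

Lemma free_limb n (y : Y n) i j : i < j -> rdesc y i j -> free (limb y) i j.
Proof.
move=> ij Dij; apply/freeP=> l ltl; apply/limbPn.
  by have := rdesc_bound Dij; rewrite (eqP (ytreeP y)); lia.
by exists i; [lia | apply: rdesc_convex Dij; lia].
Qed.

(** The fibre of [y] in coordinates. It fixes the painted set and leaves free
    only which right descendants the painted nodes gain in addition to those
    forced by [y], which is why it is an interval. *)
Lemma gamma_fibreP n (p : M n) (y : Y n) :
  gamma p = y <->
  [/\ is_painted p =1 limb y,
      forall i j, rdesc y i.+1 j.+1 -> rdesc (ptree p) i j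
    & forall i j, rdesc (ptree p) i j -> limb y i || rdesc y i.+1 j.+1].
Proof.
split=> [<- | [Pp sub_yp sub_py]].
  split=> [l|i j|i j Dij]; first by rewrite limb_gamma.
    by rewrite rdesc_gamma => /and3P[_].
  rewrite limb_gamma; have [//|nPi] := boolP (is_painted p i).
  have := rdesc_bound Dij; rewrite nodes_ptree => ijn.
  rewrite rdesc_gamma /= Dij; apply/andP; split; first by lia.
  apply/freeP=> k ltk; apply: contra nPi => Pk.
  have [_ leftp _] := paintingP p; apply: leftp Pk.
  by apply: rdesc_convex Dij; lia.
apply/le_anti/andP; split; apply/tamariP=> i j; rewrite rdesc_gamma.
  case/and3P=> ijn /implyP Dij fij.
  have [limb_i|] := boolP ((0 < i) ==> limb y i.-1).
    by apply: limb_gap => //; apply/freeP=> k /(freeP _ _ _ fij); rewrite Pp.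
  rewrite negb_imply => /andP[i_gt0 nlimb].
  by have := sub_py _ _ (Dij i_gt0); rewrite (negPf nlimb) /= !prednK //; lia.
move=> Dij; have := rdesc_bound Dij; rewrite (eqP (ytreeP y)) => ijn.
apply/and3P; split=> //.
  by apply/implyP=> i_gt0; apply: sub_yp; rewrite !prednK //; lia.
apply/freeP=> k ltk; rewrite Pp; apply: (freeP _ _ _ _ k ltk).
by apply: free_limb => //; lia.
Qed.

(** The least element of the fibre of [y], by [gamma_fibreP]: its painted
    portion is a left comb. *)
Lemma fibre_min n (y : Y n) : 0 < n -> exists p : M n,
  (forall i j, rdesc (ptree p) i j = rdesc y i.+1 j.+1) /\ is_painted p =1 limb y.
Proof.
move=> n_gt0; apply: (@M_of_painting n _ _ n_gt0).
  split=> [i j /rdesc_bound|i j k ijk|j i k]; first by rewrite (eqP (ytreeP y)); lia.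
    by apply: rdesc_convex; lia.
  exact: rdesc_trans.
split=> [i /andP[]//|i j Dij /andP[_ /climbsP/(_ i.+1)]|i j ij].
  by rewrite Dij /=; have := rdesc_bound Dij => ? H; have := H ltac:(lia).
move=> /climbsP cij limb_i; apply/negPn/limbPn; first by lia.
case=> a aj Daj; have [ai|ia] := leqP a i.
  case/andP: limb_i => _ /climbsP/(_ a); rewrite (rdesc_convex _ Daj); last by lia.
  by move=> H; have := H ltac:(lia).
by have := cij a.-1; rewrite prednK ?Daj; [move=> H; have := H ltac:(lia)|lia].
Qed.

(** The greatest element of the fibre of [y]: its painted portion is a right
    comb. *)
Lemma fibre_max n (y : Y n) : 0 < n -> exists p : M n,
  (forall i j, rdesc (ptree p) i j =
     (i < j < n.-1) && (limb y i || rdesc y i.+1 j.+1)) /\ is_painted p =1 limb y.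
Proof.
move=> n_gt0.
have limb_right i j : limb y j -> rdesc y i.+1 j.+1 -> false.
  case/andP=> _ /climbsP/(_ i.+1) H Dij; have := rdesc_bound Dij.
  by rewrite Dij in H => ?; have := H ltac:(lia).
apply: (@M_of_painting n _ _ n_gt0).
  split=> [i j /andP[]//|i j k ijk /andP[ikn Dik]|j i k].
    apply/andP; split; first by lia.
    by case/orP: Dik => [->//|Dik]; rewrite (rdesc_convex _ Dik) ?orbT //; lia.
  case/andP=> ijn Dij /andP[jkn Djk]; apply/andP; split; first by lia.
  case/orP: Dij => [->//|Dij]; case/orP: Djk => [/limb_right/(_ Dij)//|Djk].
  by rewrite (rdesc_trans Dij Djk) orbT.
split=> [i /andP[]//|i j /andP[_ /orP[//|Dij]] /limb_right/(_ Dij)//|i j ijn].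
by move=> /climbsP/(_ i) H limb_i; move: H; rewrite limb_i ijn /= leqnn; lia.
Qed.

Theorem theorem3p2 (n : nat) (n_ge1 : (1 <= n)%N) :
  interval_retract (@gamma n).
Proof.
have [g gP] := fin_all_exists (fun y => fibre_min y n_ge1).
have [h hP] := fin_all_exists (fun y => fibre_max y n_ge1).
have gK : cancel g (@gamma n).
  move=> y; have [Dg Pg] := gP y; apply/gamma_fibreP; split=> // i j; rewrite Dg //.
  by move=> ->; rewrite orbT.
have hK : cancel h (@gamma n).
  move=> y; have [Dh Ph] := hP y; apply/gamma_fibreP; split=> // i j; rewrite Dh.
    move=> Dij; have := rdesc_bound Dij; rewrite (eqP (ytreeP y)) Dij orbT andbT.
    by lia.
  by case/andP.
split.
- have [t le_t] := M_top n_ge1.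
  exact: (lattice_of_meets le_t (@M_meet n)).
- exact: gamma_homo.
- by move=> y; exists (g y).
- move=> y; exists (g y), (h y); apply/setP=> p; rewrite !inE.
  have [Dg Pg] := gP y; have [Dh Ph] := hP y.
  apply/eqP/andP=> [/gamma_fibreP[Pp sub_yp sub_py]|]; last first.
    case=> /gamma_homo le_gp /gamma_homo le_ph.
    by apply/le_anti; rewrite -{1}(hK y) -{2}(gK y) le_gp le_ph.
  split; apply/painted_leP; split; try by move=> i; rewrite ?Pg ?Ph Pp.
    by move=> i j; rewrite Dg; apply: sub_yp.
  move=> i j Dij; rewrite Dh sub_py // andbT.
  by have := rdesc_bound Dij; rewrite nodes_ptree.
- exists g => // x y le_xy; apply/painted_leP; have [Dx Px] := gP x.
  have [Dy Py] := gP y; move/tamariP: le_xy => le_xy.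
  split=> [i j|l]; first by rewrite Dx Dy; apply: le_xy.
  rewrite Px Py => /andP[ln /climbsP cl]; rewrite /limb ln /=.
  by apply/climbsP=> k /cl; apply/contra/le_xy.
Qed.
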